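(* Let $G$ be a chain graph and $\mathcal{H}$ be its canonical LWF directed acyclic hypergraph. Then a probability measure $P$ satisfies: (i) $P$ is pairwise $G$-Markovian if and only if $P$ is pairwise $\mathcal{H}$-Markovian; (ii) $P$ is local $G$-Markovian if and only if $P$ is local $\mathcal{H}$-Markovian; (iii) $P$ is global $G$-Markovian if and only if $P$ is global $\mathcal{H}$-Markovian.
   Context: A chain graph is a graph with directed and undirected edges and no partially directed cycle; its chain components are the classes of vertices connected by undirected paths. A directed hyperedge is a pair $h=(T(h),H(h))$ of disjoint vertex sets (tail, head). In a directed hypergraph, $u$ is a parent of $v$ if some hyperedge has $u$ in its tail and $v$ in its head, and $u,v$ are neighbors if they lie together in the head of some hyperedge; a directed acyclic hypergraph (DAH) has no partially directed cycle. For graphs and hypergraphs alike, $bd(v)=nb(v)\cup pa(v)$, $cl(v)=bd(v)\cup\{v\}$, $nd(v)$ is the set of non-descendants of $v$, and $ant(S)$ is the smallest ancestral set containing $S$. The shadow $\partial(\mathcal{H})$ of a DAH is the chain graph on the same vertices in which, for every hyperedge $(X,Y)$, $Y$ is made an undirected clique and each vertex of $X$ points to each vertex of $Y$. The moral graph $G^m$ of a chain graph is its underlying undirected graph with the boundary of every chain component made complete. The canonical LWF DAH $\mathcal{H}$ of a chain graph $G$ has $V(\mathcal{H})=V(G)$ and is built in two phases. Phase I: for each $v$, let $S_v$ be the children of $v$; for each maximal clique $K$ of the undirected part of $G[S_v]$ add $(\{v\},K)$; then for every maximal undirected clique $K$ of $G$ not contained in the head of an already added hyperedge, add $(\emptyset,K)$.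 Phase II: with $\mathcal{H}'$ the Phase I hypergraph and, for each chain component $\tau$ of $G$, $\mathcal{H}^*_\tau$ the hyperedges of $\mathcal{H}'_{cl(\tau)}$ whose head meets $\tau$, the edge set of $\mathcal{H}$ is the set of pairs $\big(\bigcup_{h\in E(\mathcal{H}^*_\tau),\,B\subseteq H(h)}T(h),\,B\big)$ over all $\tau$ and all $B=\bigcap_{h\in\mathcal{F}}H(h)$ with $\mathcal{F}\subseteq E(\mathcal{H}^*_\tau)$. Markov properties. For a chain graph $G$, $P$ is pairwise $G$-Markovian if $v\perp\!\!\!\perp u\mid nd(v)\setminus\{v,u\}$ for every non-adjacent pair with $u\in nd(v)$; local $G$-Markovian if $v\perp\!\!\!\perp nd(v)\setminus cl(v)\mid bd(v)$ for all $v$; global $G$-Markovian if $A\perp\!\!\!\perp B\mid C$ whenever $C$ separates $A$ and $B$ in $(G_{ant(A\cup B\cup C)})^m$. For a DAH $\mathcal{H}$, pairwise and local $\mathcal{H}$-Markovian are defined by the same formulas using the hypergraph notions of adjacency, $nd$, $bd$, $cl$; global $\mathcal{H}$-Markovian means $A\perp\!\!\!\perp B\mid C$ whenever $C$ separates $A$ and $B$ in $(\partial(\mathcal{H}_{ant(A\cup B\cup C)}))^m$. *)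

(* Defs.v *)
From mathcomp Require Import all_boot.

Set Implicit Arguments.
Unset Strict Implicit.
Unset Printing Implicit Defensive.

(* The notions below are common to graphs and directed hypergraphs: they only
   refer to the vertex set W, the relation [pa u v] (u is a parent of v) and
   the symmetric relation [nb u v] (u and v are neighbors). *)
Section Relational.
Variables (V : finType) (W : {set V}) (pa nb : rel V).

Definition adjacent : rel V := fun u v => [|| pa u v, pa v u | nb u v].

Definition bd (v : V) : {set V} := [set u in W | nb v u || pa u v].
Definition cl (v : V) : {set V} := v |: bd v.

Definition bdS (A : {set V}) : {set V} := (\bigcup_(v in A) bd v) :\: A.
Definition clS (A : {set V}) : {set V} := bdS A :|: A.

(* One step of a partially directed path. *)
Definition pstep : rel V := fun u v => pa u v || nb u v.

(* An arrow u -> v together with a path from v back to u is a partially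
   directed cycle through that arrow. *)
Definition no_pd_cycle : Prop := forall u v, pa u v -> ~~ connect pstep v u.

(* Descendants of v: the vertices that v leads to and that do not lead back
   to v.  The neighbors of v, and v itself, are thus non-descendants. *)
Definition de (v : V) : {set V} :=
  [set u in W | connect pstep v u && ~~ connect pstep u v].
Definition nd (v : V) : {set V} := W :\: de v.

Definition ancestral (A : {set V}) : bool :=
  (A \subset W) && [forall v in A, bd v \subset A].
Definition ant (A : {set V}) : {set V} :=
  \bigcap_(B : {set V} | ancestral B && (A \subset B)) B.

(* [CI A B C] is read: X_A and X_B are conditionally independent given X_C. *)
Variable CI : {set V} -> {set V} -> {set V} -> Prop.

Definition pairwise_markov : Prop :=
  forall u v : V, v \in W -> u \in nd v -> u != v -> ~~ adjacent u v ->
    CI [set v] [set u] (nd v :\: [set v; u]).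

Definition local_markov : Prop :=
  forall v : V, v \in W -> CI [set v] (nd v :\: cl v) (bd v).

End Relational.

Section Graph.
Variable V : finType.

Record mixed_graph := MixedGraph {
  gV : {set V};
  garc : rel V;
  gedge : rel V
}.

(* No arrow v -> v, and no pair joined both by an arrow and by an edge or by
   two opposite arrows: these are partially directed cycles. *)
Definition chain_graph (G : mixed_graph) : Prop :=
  [/\ forall u v, garc G u v || gedge G u v -> (u \in gV G) && (v \in gV G),
      irreflexive (gedge G),
      symmetric (gedge G)
    & no_pd_cycle (garc G) (gedge G)].

Definition induced (G : mixed_graph) (A : {set V}) : mixed_graph :=
  MixedGraph (gV G :&: A)
    (fun u v => [&& u \in A, v \in A & garc G u v])
    (fun u v => [&& u \in A, v \in A & gedge G u v]).

Definition chain_components (G : mixed_graph) : {set {set V}} :=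
  equivalence_partition (connect (gedge G)) (gV G).

Definition moral (G : mixed_graph) : mixed_graph :=
  MixedGraph (gV G) (fun _ _ => false)
    (fun u v => (u != v) &&
       [|| garc G u v, garc G v u, gedge G u v
         | [exists tau in chain_components G,
             (u \in bdS (gV G) (garc G) (gedge G) tau) &&
             (v \in bdS (gV G) (garc G) (gedge G) tau)]]).

(* C separates A and B in the undirected graph U: every path from A to B,
   trivial ones included, meets C. *)
Definition separates (U : mixed_graph) (A B C : {set V}) : Prop :=
  forall (a : V) (p : seq V), a \in A -> path (gedge U) a p ->
    last a p \in B -> has (mem C) (a :: p).

(* Cliques are non-empty: the null graph has no maximal clique. *)
Definition clique (G : mixed_graph) (K : {set V}) : bool :=
  [&& K != set0, K \subset gV G
    & [forall u in K, forall v in K, (u != v) ==> gedge G u v]].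
Definition max_clique (G : mixed_graph) (K : {set V}) : bool :=
  maxset (clique G) K.

Definition children (G : mixed_graph) (v : V) : {set V} :=
  [set u in gV G | garc G v u].

Definition hyperedge : Type := ({set V} * {set V})%type.
Definition htail (h : hyperedge) : {set V} := h.1.
Definition hhead (h : hyperedge) : {set V} := h.2.

Record hypergraph := Hypergraph {
  hV : {set V};
  hE : {set hyperedge}
}.

Definition hpa (H : hypergraph) : rel V :=
  fun u v => [exists h in hE H, (u \in htail h) && (v \in hhead h)].
Definition hnb (H : hypergraph) : rel V :=
  fun u v => (u != v) && [exists h in hE H, (u \in hhead h) && (v \in hhead h)].

Definition dah (H : hypergraph) : Prop :=
  (forall h, h \in hE H ->
     [/\ htail h \subset hV H, hhead h \subset hV H
       & [disjoint htail h & hhead h]])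
  /\ no_pd_cycle (hpa H) (hnb H).

Definition hinduced (H : hypergraph) (A : {set V}) : hypergraph :=
  Hypergraph (hV H :&: A)
    [set h in hE H | (htail h \subset A) && (hhead h \subset A)].

(* Making every head a clique and letting every tail point to its head yields
   exactly the neighbor and parent relations of H. *)
Definition shadow (H : hypergraph) : mixed_graph :=
  MixedGraph (hV H) (hpa H) (hnb H).

Definition phase1_arcs (G : mixed_graph) : {set hyperedge} :=
  [set h : hyperedge | [exists v in gV G,
     (htail h == [set v]) && max_clique (induced G (children G v)) (hhead h)]].

Definition phase1_edges (G : mixed_graph) : {set hyperedge} :=
  [set h : hyperedge | [&& htail h == set0, max_clique G (hhead h)
     & [forall h' in phase1_arcs G, ~~ (hhead h \subset hhead h')]]].

Definition phase1 (G : mixed_graph) : hypergraph :=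
  Hypergraph (gV G) (phase1_arcs G :|: phase1_edges G).

Definition star (G : mixed_graph) (tau : {set V}) : {set hyperedge} :=
  [set h in hE (hinduced (phase1 G) (clS (gV G) (garc G) (gedge G) tau))
     | hhead h :&: tau != set0].

(* The family F is non-empty: an empty intersection would be the set of all
   vertices, which is not meant to become a head. *)
Definition canonical_LWF (G : mixed_graph) : hypergraph :=
  Hypergraph (gV G)
    [set h : hyperedge | [exists tau in chain_components G,
       [exists F : {set hyperedge},
         [&& F != set0, F \subset star G tau,
             hhead h == \bigcap_(f in F) hhead f
           & htail h == \bigcup_(f in star G tau | hhead h \subset hhead f)
                         htail f]]]].

Variable CI : {set V} -> {set V} -> {set V} -> Prop.

Definition g_pairwise (G : mixed_graph) : Prop :=
  pairwise_markov (gV G) (garc G) (gedge G) CI.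
Definition g_local (G : mixed_graph) : Prop :=
  local_markov (gV G) (garc G) (gedge G) CI.
Definition g_global (G : mixed_graph) : Prop :=
  forall A B C : {set V},
    A \subset gV G -> B \subset gV G -> C \subset gV G ->
    separates
      (moral (induced G (ant (gV G) (garc G) (gedge G)
                             (A :|: B :|: C)))) A B C ->
    CI A B C.

Definition h_pairwise (H : hypergraph) : Prop :=
  pairwise_markov (hV H) (hpa H) (hnb H) CI.
Definition h_local (H : hypergraph) : Prop :=
  local_markov (hV H) (hpa H) (hnb H) CI.
Definition h_global (H : hypergraph) : Prop :=
  forall A B C : {set V},
    A \subset hV H -> B \subset hV H -> C \subset hV H ->
    separates
      (moral (shadow (hinduced H (ant (hV H) (hpa H) (hnb H)
                                     (A :|: B :|: C))))) A B C ->
    CI A B C.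

Lemma canonical_LWF_dah (G : mixed_graph) :
  chain_graph G -> dah (canonical_LWF G).
Proof.
case=> inV _ _ acyc.
have cliqueE S K u v : max_clique (induced G S) K ->
    u \in K -> v \in K -> u != v -> gedge G u v.
  case/maxsetp/and3P=> _ _ /forallP/(_ u)/implyP HK uK vK neq.
  by move: (HK uK) => /forallP/(_ v)/implyP/(_ vK)/implyP/(_ neq)/and3P[].
have p1V f : f \in hE (phase1 G) ->
    (htail f \subset gV G) /\ (hhead f \subset gV G).
  rewrite !inE => /orP[/exists_inP[w wV /andP[/eqP-> /maxsetp/and3P[_ sK _]]]|].
    by rewrite sub1set; split=> //; apply: subset_trans sK (subsetIl _ _).
  by case/and3P=> /eqP-> /maxsetp/and3P[_ sK _] _; split=> //; apply: sub0set.
have p1pa f u v : f \in hE (phase1 G) -> u \in htail f ->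
    v \in hhead f -> garc G u v.
  rewrite !inE => /orP[/exists_inP[w _ /andP[/eqP-> /maxsetp/and3P[_ sK _]]]|].
    by rewrite inE => /eqP-> /(subsetP sK); rewrite !inE => /and3P[].
  by case/and3P=> /eqP->; rewrite inE.
have p1nb f u v : f \in hE (phase1 G) -> u \in hhead f -> v \in hhead f ->
    u != v -> gedge G u v.
  rewrite !inE => /orP[/exists_inP[w _ /andP[_]]|]; first exact: cliqueE.
  case/and3P=> _ /maxsetp/and3P[_ _ /forall_inP HK] _ uK vK.
  by move: (HK _ uK) => /forall_inP/(_ _ vK)/implyP.
have starP tau f : f \in star G tau -> f \in hE (phase1 G).
  by rewrite inE => /andP[]; rewrite inE => /andP[].
have inj h : h \in hE (canonical_LWF G) ->
    exists2 f, f \in hE (phase1 G) & hhead h \subset hhead f.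
  rewrite inE => /exists_inP[tau _ /existsP[F /and4P[/set0Pn[f fF] sF /eqP-> _]]].
  by exists f; [apply: starP (subsetP sF _ fF) | apply: bigcap_inf].
have tl h u : h \in hE (canonical_LWF G) -> u \in htail h ->
    exists f, [/\ f \in hE (phase1 G), hhead h \subset hhead f & u \in htail f].
  rewrite inE => /exists_inP[tau _ /existsP[F /and4P[_ _ _ /eqP->]]].
  by case/bigcupP=> f /andP[/starP fH sf] uf; exists f.
have hpaE u v : hpa (canonical_LWF G) u v -> garc G u v.
  case/exists_inP=> h hH /andP[/(tl _ _ hH)[f [fH sf uf]] vh].
  exact: p1pa fH uf (subsetP sf _ vh).
have hnbE u v : hnb (canonical_LWF G) u v -> gedge G u v.
  case/andP=> neq /exists_inP[h /inj[f fH sf] /andP[uh vh]].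
  by apply: p1nb fH _ _ neq; apply: (subsetP sf).
split=> [h hH|u v /hpaE/acyc]; last first.
  apply: contra; apply: connect_sub => x y /orP[/hpaE|/hnbE] e;
  by apply: connect1; rewrite /pstep e ?orbT.
split.
- by apply/subsetP=> u /(tl _ _ hH)[f [/p1V[sV _] _ uf]]; apply: (subsetP sV).
- by have [f /p1V[_ sV] sf] := inj _ hH; apply: subset_trans sf sV.
rewrite disjoint_subset; apply/subsetP=> u ut; rewrite inE; apply/negP=> uh.
have [f [fH sf uf]] := tl _ _ hH ut.
by move: (acyc _ _ (p1pa _ _ _ fH uf (subsetP sf _ uh))); rewrite connect0.
Qed.

End Graph.

From mathcomp Require Import all_order all_algebra.
From mathcomp Require Import all_classical all_reals all_analysis.

Local Open Scope classical_set_scope.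
Local Open Scope ring_scope.
Local Open Scope ereal_scope.

Section ConditionalIndependence.
Context (R : realType) (d : measure_display) (Omega : measurableType d)
  (P : probability Omega R).

(* f is a version of the conditional probability of the event E given the
   sub-sigma-algebra F. *)
Definition is_cond_prob (F : set (set Omega)) (E : set Omega)
    (f : Omega -> R) : Prop :=
  [/\ forall B : set R, measurable B -> F (f @^-1` B),
      P.-integrable setT (EFin \o f)
    & forall D, F D -> \int[P]_(x in D) (f x)%:E = P (E `&` D)].

(* Conditional independence of the sigma-algebras F1 and F2 given F3. *)
Definition cond_indep_sigma (F1 F2 F3 : set (set Omega)) : Prop :=
  forall E1 E2, F1 E1 -> F2 E2 ->
    exists f1 f2 f12 : Omega -> R,
      [/\ is_cond_prob F3 E1 f1, is_cond_prob F3 E2 f2,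
          is_cond_prob F3 (E1 `&` E2) f12
        & {ae P, forall x, f12 x = (f1 x * f2 x)%R}].

Context (V : finType) (dS : V -> measure_display)
  (S : forall v, measurableType (dS v)) (X : forall v, {mfun Omega >-> S v}).

(* The sigma-algebra generated by (X_v), v in A. *)
Definition sigma_of (A : {set V}) : set (set Omega) :=
  <<s \bigcup_(v in [set` A]) preimage_set_system setT (X v) measurable >>.

Definition cond_indep (A B C : {set V}) : Prop :=
  cond_indep_sigma (sigma_of A) (sigma_of B) (sigma_of C).

End ConditionalIndependence.

(* Main.v *)
(* The canonical hypergraph has exactly the parent and neighbor relations of G:
   every arrow v -> w lies in some ({v}, K) with K a maximal clique of children
   of v containing w, every edge lies in a maximal clique, and the Phase II
   closure keeps all heads of Phase I and only enlarges tails by parents.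
   Hence (i) and (ii) are literally the same conditions. For (iii), a hyperedge
   whose head meets an ancestral set is contained in that set, so the shadow of
   the induced hypergraph is the induced subgraph of G. *)
Require Import Defs.
From mathcomp Require Import all_boot all_order all_algebra.
From mathcomp Require Import all_classical all_reals all_analysis.

Section Canonical.
Import mathcomp.boot.fintype mathcomp.boot.finset Defs.
Set Implicit Arguments.
Unset Strict Implicit.

(** Being closed under boundaries survives intersection. This supplies the hypothesis of
    [shadow_induced_canonical]. *)
Lemma bd_ant (V : finType) (W : {set V}) (pa nb : rel V) (A : {set V}) v :
  v \in ant W pa nb A -> bd W pa nb v \subset ant W pa nb A.
Proof.
move=> /bigcapP vA; apply/bigcapsP => B BP.
have /andP[/andP[_ /forall_inP bdB] _] := BP.
exact: bdB (vA _ BP).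
Qed.

Variables (V : finType) (G : mixed_graph V).
Hypothesis hG : chain_graph G.

Lemma gedgeV u v : gedge G u v -> (u \in gV G) && (v \in gV G).
Proof. by case: hG => inV _ _ _ uv; apply: inV; rewrite uv orbT. Qed.

Lemma garcV u v : garc G u v -> (u \in gV G) && (v \in gV G).
Proof. by case: hG => inV _ _ _ uv; apply: inV; rewrite uv. Qed.

Lemma gedgeC : symmetric (gedge G). Proof. by case: hG. Qed.

Lemma clique_gedge K u v :
  clique G K -> u \in K -> v \in K -> u != v -> gedge G u v.
Proof.
by case/and3P=> _ _ /forall_inP KP /KP/forall_inP uP /uP/implyP.
Qed.

(** Lets the heads of [phase1_arcs], cliques among the children of a vertex, be handled as cliques
    of [G]. *)
Lemma clique_induced S K : clique (induced G S) K = clique G K && (K \subset S).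
Proof.
apply/and3P/andP => [[K0 /=]|[/and3P[K0 KV /forall_inP KP] KS]].
  rewrite subsetI => /andP[KV KS] /forall_inP KP; split=> //.
  rewrite /clique K0 KV; apply/forall_inP => u uK; apply/forall_inP => v vK.
  apply/implyP => uv; have /forall_inP/(_ v vK)/implyP/(_ uv) := KP u uK.
  by case/and3P.
split=> //=; first by rewrite subsetI KV.
apply/forall_inP => u uK; apply/forall_inP => v vK; apply/implyP => uv.
rewrite (subsetP KS _ uK) (subsetP KS _ vK) /=.
by have /forall_inP/(_ v vK)/implyP/(_ uv) := KP u uK.
Qed.

Lemma clique1 v : v \in gV G -> clique G [set v].
Proof.
move=> vV; apply/and3P; split; last 1 first.
- apply/forall_inP => x /set1P->; apply/forall_inP => y /set1P->.
  by rewrite eqxx.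
- by apply/set0Pn; exists v; rewrite set11.
- by rewrite sub1set.
Qed.

Lemma clique2 u v : gedge G u v -> clique G [set u; v].
Proof.
move=> uv; have /andP[uV vV] := gedgeV uv.
apply/and3P; split; last 1 first.
- apply/forall_inP => x /set2P[]->; apply/forall_inP => y /set2P[]->;
  by rewrite ?eqxx // ?uv ?implybT // gedgeC uv implybT.
- by apply/set0Pn; exists u; rewrite set21.
- by rewrite subUset !sub1set uV.
Qed.

Lemma phase1_pa f u v : f \in hE (phase1 G) ->
  u \in htail f -> v \in hhead f -> garc G u v.
Proof.
rewrite !inE => /orP[/exists_inP[w _ /andP[/eqP-> /maxsetp]]|].
  rewrite clique_induced inE => /andP[_ /subsetP sK] /eqP-> /sK.
  by rewrite inE => /andP[].
by case/and3P=> /eqP->; rewrite inE.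
Qed.

Lemma phase1_clique f : f \in hE (phase1 G) -> clique G (hhead f).
Proof.
rewrite !inE => /orP[/exists_inP[w _ /andP[_ /maxsetp]]|].
  by rewrite clique_induced => /andP[].
by case/and3P=> _ /maxsetp.
Qed.

Lemma star_phase1 tau f : f \in star G tau -> f \in hE (phase1 G).
Proof. by rewrite inE => /andP[]; rewrite inE => /andP[]. Qed.

(** The head is a clique, so it lies in the chain component of [w]; the tail consists of parents of
    [w], so it lies in the closure of that component. Restricting to closures thus loses no Phase I
    hyperedge. *)
Lemma phase1_star f w : f \in hE (phase1 G) -> w \in hhead f ->
  exists2 tau, tau \in chain_components G & f \in star G tau.
Proof.
move=> fH wf; have fK := phase1_clique fH.
have /and3P[_ /subsetP fV _] := fK.
pose tau := [set y in gV G | connect (gedge G) w y].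
have ftau : hhead f \subset tau.
  apply/subsetP => y yf; rewrite inE fV //=.
  have [->|wy] := eqVneq w y; first exact: connect0.
  exact: connect1 (clique_gedge fK wf yf wy).
have tau_cl : tau \subset clS (gV G) (garc G) (gedge G) tau by exact: subsetUr.
exists tau; first by apply/imsetP; exists w; rewrite // fV.
rewrite inE inE fH (subset_trans ftau tau_cl) andbT /=.
apply/andP; split; last first.
  by apply/set0Pn; exists w; rewrite inE wf (subsetP ftau).
apply/subsetP => u uf; have uw := phase1_pa fH uf wf.
have /andP[uV _] := garcV uw.
(* [bdS] removes [tau] itself; splitting here avoids an appeal to acyclicity to exclude a parent
   inside [tau]. *)
have [utau|utau] := boolP (u \in tau); first exact: (subsetP tau_cl).
rewrite inE; apply/orP; left; rewrite inE utau /=.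
by apply/bigcupP; exists w; rewrite ?(subsetP ftau) // inE uV uw orbT.
Qed.

Lemma canonical_sub_phase1 h : h \in hE (canonical_LWF G) ->
  exists2 f, f \in hE (phase1 G) & hhead h \subset hhead f.
Proof.
rewrite inE => /exists_inP[tau _ /existsP[F /and4P[/set0Pn[f fF] sF /eqP-> _]]].
by exists f; [apply: star_phase1 (subsetP sF _ fF) | apply: bigcap_inf].
Qed.

(** The singleton family [[set f]] reproduces the head of [f], and [f] is then one of the hyperedges
    whose tails are united. *)
Lemma phase1_sub_canonical f w : f \in hE (phase1 G) -> w \in hhead f ->
  exists h, [/\ h \in hE (canonical_LWF G), hhead h = hhead f
              & htail f \subset htail h].
Proof.
move=> fH /(phase1_star fH)[tau taucc fs].
exists (\bigcup_(g in star G tau | hhead f \subset hhead g) htail g, hhead f).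
split=> //.
  rewrite inE; apply/exists_inP; exists tau => //.
  apply/existsP; exists [set f]; rewrite sub1set fs big_set1 !eqxx !andbT.
  by apply/set0Pn; exists f; rewrite set11.
by apply: bigcup_sup; rewrite fs /=.
Qed.

(** Enlarging tails creates no parent: each tail in the union comes from a Phase I hyperedge whose
    head contains the new head. *)
Lemma hpa_canonical : hpa (canonical_LWF G) =2 garc G.
Proof.
move=> u v; apply/idP/idP => [/exists_inP[h]|uv].
  rewrite inE => /exists_inP[tau _ /existsP[F /and4P[_ _ _ /eqP->]]].
  case/andP=> /bigcupP[f /andP[/star_phase1 fH sf] uf] vh.
  exact: phase1_pa fH uf (subsetP sf _ vh).
have /andP[uV vV] := garcV uv.
(* Extending [[set v]] to a maximal clique of children of [u] gives the Phase I hyperedge that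
   carries the arrow. *)
have cv : clique (induced G (children G u)) [set v].
  by rewrite clique_induced clique1 // sub1set inE vV.
have [K Kmax] := maxset_exists cv; rewrite sub1set => vK.
have fH : ([set u], K) \in hE (phase1 G).
  by rewrite !inE; apply/orP; left; apply/exists_inP; exists u; rewrite // eqxx.
have [h [hH hK uh]] := phase1_sub_canonical fH vK.
by apply/exists_inP; exists h; rewrite // hK (subsetP uh) ?set11.
Qed.

Lemma hnb_canonical : hnb (canonical_LWF G) =2 gedge G.
Proof.
move=> u v; apply/idP/idP => [|uv].
  case/andP=> uv /exists_inP[h /canonical_sub_phase1[f fH sf] /andP[uh vh]].
  by apply: clique_gedge (phase1_clique fH) _ _ uv; apply: (subsetP sf).
have [K Kmax] := maxset_exists (clique2 uv).
rewrite subUset !sub1set => /andP[uK vK].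
have [f fH sf] : exists2 f, f \in hE (phase1 G) & K \subset hhead f.
  (* Phase I adds [K] with an empty tail unless some head of [phase1_arcs] contains it, and then
     that head already joins [u] and [v]. *)
  have [/forall_inP KP|] := boolP [forall h in phase1_arcs G, ~~ (K \subset hhead h)].
    exists (set0, K) => //; rewrite inE; apply/orP; right.
    by rewrite inE eqxx /max_clique Kmax; apply/forall_inP.
  by case/forall_inPn => f fA /negPn sf; exists f; rewrite // inE fA.
have [uf vf] := (subsetP sf _ uK, subsetP sf _ vK).
have [h [hH hf _]] := phase1_sub_canonical fH uf.
apply/andP; split; last by apply/exists_inP; exists h; rewrite // hf uf.
by case: hG => _ irr _ _; apply: contraTneq uv => ->; rewrite irr.
Qed.

(** Induced hyperedges must lie wholly in [A], which could lose adjacencies inside [A]. Closure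
    under boundaries prevents it: for a head vertex [v] in [A], the tail consists of parents of [v]
    and the rest of the head of neighbors of [v]. *)
Lemma shadow_induced_canonical (A : {set V}) :
  (forall v, v \in A -> bd (gV G) (garc G) (gedge G) v \subset A) ->
  shadow (hinduced (canonical_LWF G) A) = induced G A.
Proof.
move=> Abd.
have hedgeA h v : h \in hE (canonical_LWF G) -> v \in hhead h -> v \in A ->
    h \in hE (hinduced (canonical_LWF G) A).
  move=> hH vh vA; have /subsetP bdA := Abd v vA.
  rewrite inE hH /=; apply/andP; split; apply/subsetP => x xh.
    apply: bdA.
    have xv : garc G x v.
      by rewrite -hpa_canonical; apply/exists_inP; exists h; rewrite // xh.
    by have /andP[xV _] := garcV xv; rewrite inE xV xv orbT.
  have [->//|xv] := eqVneq x v.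
  apply: bdA; have {}xv : gedge G x v.
    by rewrite -hnb_canonical /hnb xv; apply/exists_inP; exists h; rewrite // xh.
  by have /andP[xV _] := gedgeV xv; rewrite inE xV gedgeC xv.
congr MixedGraph; apply/funext => u; apply/funext => v.
- rewrite -hpa_canonical; apply/exists_inP/and3P => [[h]|[uA vA]].
    rewrite inE => /and3P[hH tA hA] /andP[ut vh].
    split; [exact: (subsetP tA)|exact: (subsetP hA)|].
    by apply/exists_inP; exists h; rewrite // ut.
  case/exists_inP=> h hH /andP[ut vh].
  by exists h; rewrite ?ut //; apply: hedgeA vh vA.
- rewrite -hnb_canonical; apply/andP/and3P => [[uv /exists_inP[h]]|[uA vA]].
    rewrite inE => /and3P[hH tA hA] /andP[uh vh].
    split; [exact: (subsetP hA)|exact: (subsetP hA)|].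
    by rewrite /hnb uv; apply/exists_inP; exists h; rewrite // uh.
  case/andP=> uv /exists_inP[h hH /andP[uh vh]]; split=> //.
  by apply/exists_inP; exists h; rewrite ?uh //; apply: hedgeA vh vA.
Qed.

End Canonical.

Theorem theorem3 (V : finType) (G : mixed_graph V) (hG : chain_graph G)
    (R : realType) (d : measure_display) (Omega : measurableType d)
    (P : probability Omega R)
    (dS : V -> measure_display) (S : forall v : V, measurableType (dS v))
    (X : forall v : V, {mfun Omega >-> S v}) :
  [/\ g_pairwise (cond_indep P X) G <->
        h_pairwise (cond_indep P X) (canonical_LWF G),
      g_local (cond_indep P X) G <->
        h_local (cond_indep P X) (canonical_LWF G)
    & g_global (cond_indep P X) G <->
        h_global (cond_indep P X) (canonical_LWF G)].
Proof.
have paE : hpa (canonical_LWF G) = garc G.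
  by apply/funext => u; apply/funext => v; apply: hpa_canonical.
have nbE : hnb (canonical_LWF G) = gedge G.
  by apply/funext => u; apply/funext => v; apply: hnb_canonical.
split; first by rewrite /h_pairwise paE nbE.
  by rewrite /h_local paE nbE.
have shE A : shadow (hinduced (canonical_LWF G)
      (ant (gV G) (garc G) (gedge G) A)) =
    Defs.induced G (ant (gV G) (garc G) (gedge G) A).
  by apply: shadow_induced_canonical => // v; apply: bd_ant.
(* [ant] sees the hypergraph only through its vertices, [hpa] and [hnb], so both properties now use
   the same ancestral set. *)
by rewrite /h_global paE nbE; split=> GM A B C AV BV CV;
  have := GM A B C AV BV CV; rewrite shE.
Qed.
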